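(* Let $X$ be an infinite Hausdorff topological space. If $(Q(X),\tau_p)$ is completely metrizable, then $X$ is countable and $I(X)$ is dense in $X$.
   Context: A function $f: X\to\mathbb{R}$ is quasicontinuous at $x\in X$ if for every open $V\subset\mathbb{R}$ with $f(x)\in V$ and every open $U\subset X$ with $x\in U$ there is a nonempty open set $W\subset U$ with $f(W)\subset V$; $f$ is quasicontinuous if it is quasicontinuous at every point of $X$. $Q(X)$ is the set of all quasicontinuous functions $X\to\mathbb{R}$. $\tau_p$ is the topology of pointwise convergence, i.e. the topology on $Q(X)$ as a subspace of $\mathbb{R}^X$ with the product topology. $I(X)$ denotes the set of all isolated points of $X$. *)

(* Defs.v *)
From HB Require Import structures.
From mathcomp Require Import all_boot all_order all_algebra.
From mathcomp Require Import all_classical all_reals all_analysis.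

Set Implicit Arguments.
Unset Strict Implicit.
Unset Printing Implicit Defensive.

Import Order.TTheory GRing.Theory Num.Theory.
Import numFieldNormedType.Exports.

Local Open Scope classical_set_scope.
Local Open Scope ring_scope.

Definition quasicontinuous_at (X Y : topologicalType) (f : X -> Y) (x : X) :=
  forall (V : set Y) (U : set X), open V -> V (f x) -> open U -> U x ->
    exists W : set X, [/\ open W, W !=set0, W `<=` U & f @` W `<=` V].

Definition quasicontinuous (X Y : topologicalType) (f : X -> Y) :=
  forall x : X, quasicontinuous_at f x.

Definition Q (R : realType) (X : topologicalType) : set {ptws X -> R} :=
  [set f | quasicontinuous (f : X -> R)].
Arguments Q : clear implicits.

(* The structure inferred on [set_type (Q R X)] is the topology induced by the
   product topology of [{ptws X -> R}]. *)
Definition Qp (R : realType) (X : topologicalType) : topologicalType :=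
  set_type (Q R X).

Definition metric_complete (R : realType) (M : metricType R) :=
  forall u : nat -> M, cauchy (u @ \oo) -> exists l : M, u @ \oo --> l.

(* [T] is homeomorphic to a complete metric space; transporting the distance
   along the homeomorphism, this says that some complete metric on [T] induces
   the topology of [T]. *)
Definition completely_metrizable (R : realType) (T : topologicalType) :=
  exists (M : metricType R) (h : T -> M) (g : M -> T),
    [/\ cancel h g, cancel g h, continuous h, continuous g
      & metric_complete M].

(* Main.v *)
Require Import Defs.
From mathcomp Require Import all_boot all_order all_algebra.
From mathcomp Require Import all_classical all_reals all_analysis.
From mathcomp Require Import zify lra.

Local Open Scope classical_set_scope.

Set Implicit Arguments.
Unset Strict Implicit.
Unset Printing Implicit Defensive.

Import Order.TTheory GRing.Theory Num.Theory.
Import numFieldNormedType.Exports.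

Local Open Scope ring_scope.

(** Everything rests on two facts that hold for every Hausdorff [X]: a
quasicontinuous function can take any prescribed values on a finite set
([quasicontinuous_interpolation]), and a neighbourhood of [f] in [Q(X)] contains
all functions that agree with [f] on some finite set ([nbhs_Qp_agree]).

Countability needs only a countable neighbourhood basis at one point [f]. Each
basic neighbourhood contains all functions agreeing with [f] on a finite set;
if some [x] were outside the union of these countably many finite sets, one
could change the value at [x] inside every basic neighbourhood, although
evaluation at [x] is continuous.

For the density of the isolated points, completeness is used in the manner of
the Baire category theorem: as [X] is countable, [R^X] is completely metrizable
and [Q(X)] is a dense G-delta set in it, so
it meets its image under the homeomorphism [f |-> h - f] for every
[h : X -> R]. Hence every [h] is a sum of two quasicontinuous functions
([sums_of_completely_metrizable]); the proof below builds the two summands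
directly, as the limits of the even and the odd terms of one sequence. But a sum
of two quasicontinuous functions has small oscillation on some nonempty open
subset of any given nonempty open set ([quasicontinuous_sum_cliquish]). If
[h] is injective with values in the natural numbers, oscillation less than 1
leaves only one point, which is therefore isolated. *)

(** * Interpolation by quasicontinuous functions *)

Lemma hausdorff_open_closure_notin (X : topologicalType) (x : X) (s : seq X) :
  hausdorff_space X -> x \notin s ->
  exists U : set X, [/\ open U, U x & forall y, y \in s -> ~ closure U y].
Proof.
rewrite open_hausdorff => hX; elim: s => [|y s IH].
  by exists setT; split => //; exact: openT.
rewrite inE negb_or => /andP[xy /IH[U [oU Ux Us]]].
have [[A B] /= [xA yB] [oA oB /eqP AB0]] := hX _ _ xy.
move: xA yB; rewrite !inE => Ax By.
exists (U `&` A); split => //; first exact: openI.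
move=> z; rewrite inE => /predU1P[->|zs] clz.
  have [t [[_ At] Bt]] := clz B (open_nbhs_nbhs (conj oB By)).
  by have : (A `&` B) t by []; rewrite AB0.
by apply: (Us z zs); apply: closureS clz; exact: subIsetl.
Qed.

Lemma quasicontinuous_cst (X Y : topologicalType) (c : Y) :
  quasicontinuous (fun _ : X => c).
Proof.
move=> x V U _ Vc oU Ux; exists U; split => //; first by exists x.
by move=> _ [y _ <-].
Qed.

(** A point of [closure U] is approached from the open set [U], where the new
function is constant, and the complement of [closure U] is open, so there [f]
keeps its quasicontinuity. With [U] in place of its closure this can fail at
boundary points. *)
Lemma quasicontinuous_patch_closure (X Y : topologicalType) (U : set X) (c : Y)
    (f : X -> Y) :
  open U -> quasicontinuous f ->
  quasicontinuous (fun x => if x \in closure U then c else f x).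
Proof.
move=> oU qf x V N oV; case: ifPn => [|]; rewrite ?notin_setE ?inE.
  move=> clx Vc oN Nx.
  have [y [Uy Ny]] := clx N (open_nbhs_nbhs (conj oN Nx)).
  exists (N `&` U); split; [exact: openI|by exists y|exact: subIsetl|].
  move=> _ [z [_ Uz] <-]; rewrite ifT// inE.
  exact: subset_closure.
move=> nclx Vfx oN Nx.
have oNU : open (N `&` ~` closure U).
  by apply: openI => //; apply: closed_openC; exact: closed_closure.
have [W [oW W0 WN fWV]] := qf x V _ oV Vfx oNU (conj Nx nclx).
exists W; split => // [z /WN[]//|_ [z Wz <-]].
case: ifPn => [|_]; last by apply: fWV; exists z.
by rewrite inE => clz; have [] := WN z Wz.
Qed.

(** The values are imposed one point at a time: a new point [x] has an open
neighbourhood whose closure misses the earlier points, and the function is made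
constant on that closure. *)
Lemma quasicontinuous_interpolation (R : realType) (X : topologicalType)
    (s : seq X) (a : X -> R) :
  hausdorff_space X ->
  exists f : Qp R X, forall x, x \in s -> val f x = a x.
Proof.
move=> hX.
suff [f qf fs] : exists2 f : X -> R, quasicontinuous f &
    forall x, x \in s -> f x = a x.
  have Qf : (f : {ptws X -> R}) \in Q R X by rewrite inE.
  by exists (exist _ f Qf) => x xs /=; exact: fs.
elim: s => [|x s [f qf fs]].
  by exists (fun=> 0) => //; exact: quasicontinuous_cst.
have [xs|xs] := boolP (x \in s).
  by exists f => // y; rewrite inE => /predU1P[->|]; exact: fs.
have [U [oU Ux Us]] := hausdorff_open_closure_notin hX xs.
exists (fun y => if y \in closure U then a x else f y).
  exact: quasicontinuous_patch_closure.
move=> y; rewrite inE => /predU1P[->|ys].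
  by rewrite ifT// inE; exact: subset_closure.
by rewrite ifF ?fs//; apply/negbTE; rewrite notin_setE; exact: Us.
Qed.

(** * The topology of pointwise convergence *)

(** The sets of functions agreeing with [f] on a finite set generate a filter
that converges to [f] at every point of [X], hence it is finer than the
neighbourhood filter of [f]. These sets are in general not neighbourhoods
themselves, but they allow exact values to be prescribed in place of
approximate ones. *)
Lemma nbhs_Qp_agree (R : realType) (X : topologicalType) (f : Qp R X)
    (A : set (Qp R X)) :
  nbhs f A ->
  exists s : seq X, forall g : Qp R X,
    (forall x, x \in s -> val g x = val f x) -> A g.
Proof.
pose D (s : seq X) : set (Qp R X) :=
  [set g | forall x, x \in s -> val g x = val f x].
pose F : set_system (Qp R X) := [set B | exists s, D s `<=` B].
have FF : Filter F.
  split=> [|B C [s sB] [t tC]|B C BC [s sB]]; last by exists s; exact: subset_trans BC.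
  - by exists [::].
  - exists (s ++ t) => g Dg.
    split; [apply: sB => x xs|apply: tC => x xt]; apply: Dg.
      by rewrite mem_cat xs.
    by rewrite mem_cat xt orbT.
suff : F --> f by apply.
have cvF : {ptws, (val : Qp R X -> X -> R) @ F --> (val f : X -> R)}.
  apply/pointwise_cvgP => x B /nbhs_singleton Bfx.
  by exists [:: x] => g Dg /=; rewrite Dg ?inE.
move=> B; rewrite nbhsE => -[W [[V oV <-] Vf] WB].
have [s sV] := cvF V (open_nbhs_nbhs (conj oV Vf)).
by exists s => g /sV/WB.
Qed.

Lemma Qp_eval_continuous (R : realType) (X : topologicalType) (x : X) :
  continuous (fun f : Qp R X => val f x).
Proof.
move=> f.
have cf := @initial_continuous (set_type (Q R X)) {ptws X -> R} set_val f.
have := @proj_continuous X (fun=> R) x (val f).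
rewrite set_valE in cf.
move=> cp A /cp nA; exact: (cf _ nA).
Qed.

(** A point outside all the finite sets that control the [B n] would be
invisible to the neighbourhoods of [f]: every [B n] would contain a function
whose value there is [f x + 1]. *)
Lemma countable_of_countable_nbhs_basis (R : realType) (X : topologicalType)
    (f : Qp R X) (B : nat -> set (Qp R X)) :
  hausdorff_space X -> (forall n, nbhs f (B n)) ->
  (forall A, nbhs f A -> exists n, B n `<=` A) -> countable [set: X].
Proof.
move=> hX Bf Bbase.
have [s sB] := choice (fun n => nbhs_Qp_agree (Bf n)).
suff -> : [set: X] = \bigcup_n [set` s n].
  by apply: bigcup_countable => // n _; exact: finite_set_countable.
apply/esym/seteqP; split=> // x _; apply: contrapT => xs.
have : nbhs f [set g : Qp R X | ball (val f x) 1 (val g x)].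
  exact: (Qp_eval_continuous (nbhsx_ballx _ _ ltr01)).
move=> /Bbase[n BnA].
have [g gE] := quasicontinuous_interpolation (x :: s n)
  (fun y => if y == x then val f x + 1 else val f y) hX.
have : B n g.
  apply: sB => y ys; rewrite gE ?inE ?ys ?orbT//.
  by case: eqP => // yx; case: xs; exists n => //=; rewrite -yx.
move=> /BnA /=; rewrite gE ?mem_head// eqxx /ball/=.
by rewrite opprD addNKr normrN1 ltxx.
Qed.

(** * Sums of two quasicontinuous functions *)

(** The radii telescope because [2^-n = 2^-(n+1) + 2^-(n+1)]: one half is spent
on the first step, the other on all the later ones. *)
Lemma ball_geometric (R : realType) (M : pseudoMetricType R) (v : nat -> M) :
  (forall n, ball (v n) (2^-1 ^+ n.+1) (v n.+1)) ->
  forall n k, ball (v n) (2^-1 ^+ n) (v (n + k)%N).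
Proof.
move=> vS n k; elim: k n => [|k IH] n.
  by rewrite addn0; apply: ballxx; rewrite exprn_gt0// invr_gt0.
rewrite addnS -addSn [2^-1 ^+ n](_ : _ = 2^-1 ^+ n.+1 + 2^-1 ^+ n.+1).
  exact: ball_triangle (vS n) (IH _).
by rewrite exprSr; lra.
Qed.

Lemma cauchy_geometric (R : realType) (M : pseudoMetricType R) (v : nat -> M) :
  (forall n, ball (v n) (2^-1 ^+ n.+1) (v n.+1)) -> cauchy (v @ \oo).
Proof.
move=> vS; apply: cauchy_exP => e e0.
have [N _ /(_ N (leqnn N)) Ne] : \forall n \near \oo, (2^-1 : R) ^+ n < e.
  have : (fun n => (2^-1 : R) ^+ n) @ \oo --> (0 : R).
    by apply: cvg_expr; rewrite ger0_norm ?invr_ge0// invf_lt1// ltr1n.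
  by move=> /cvgrPdist_lt/(_ e e0); apply: filterS => n;
    rewrite sub0r normrN ger0_norm// exprn_ge0// invr_ge0.
exists (v N), N => // n /= Nn; rewrite -(subnKC Nn).
by apply: le_ball (ball_geometric vS _ _); exact: ltW.
Qed.

(** Quasicontinuity of [f] at a point of [U] shrinks [U] to an open set on which
[f] varies little, and quasicontinuity of [g] at a point of this smaller set
shrinks it further. *)
Lemma quasicontinuous_sum_cliquish (R : realType) (X : topologicalType)
    (f g : X -> R) (U : set X) (e : R) :
  quasicontinuous f -> quasicontinuous g -> open U -> U !=set0 -> 0 < e ->
  exists W : set X, [/\ open W, W !=set0, W `<=` U &
    forall x y, W x -> W y -> `|(f x + g x) - (f y + g y)| < e].
Proof.
move=> qf qg oU [x Ux] e0.
have e4 : 0 < e / 4 by rewrite divr_gt0.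
have [W [oW [y Wy] WU fW]] := qf x (ball (f x) (e / 4)) U
  (ball_open _ _) (ballxx _ e4) oU Ux.
have [W' [oW' W'0 W'W gW']] := qg y (ball (g y) (e / 4)) W
  (ball_open _ _) (ballxx _ e4) oW Wy.
exists W'; split => //; first exact: subset_trans WU.
move=> a b W'a W'b.
have fn z : W' z -> `|f x - f z| < e / 4.
  by move=> /W'W Wz; apply: fW; exists z.
have gn z : W' z -> `|g y - g z| < e / 4.
  by move=> W'z; apply: gW'; exists z.
move: (fn a W'a) (fn b W'b) (gn a W'a) (gn b W'b).
rewrite !ltr_norml => /andP[? ?] /andP[? ?] /andP[? ?] /andP[? ?].
by apply/andP; split; lra.
Qed.

(** The function to decompose is an injection of [X] into the natural numbers:
on a set with at least two points it has oscillation at least 1. *)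
Lemma dense_isolated_of_sums (R : realType) (X : topologicalType) :
  countable [set: X] ->
  (forall h : X -> R, exists f g : Qp R X, forall x, val f x + val g x = h x) ->
  dense (isolated [set: X]).
Proof.
move=> /countable_injP[c c_inj] sums U U0 oU.
have [f [g fgE]] := sums (fun x => (c x)%:R).
have qf : quasicontinuous (val f : X -> R) by have /set_mem := valP f.
have qg : quasicontinuous (val g : X -> R) by have /set_mem := valP g.
have [W [oW [x Wx] WU Wsmall]] :=
  quasicontinuous_sum_cliquish qf qg oU U0 ltr01.
exists x; split; first exact: WU.
split; first by rewrite inE.
exists W; first exact: open_nbhs_nbhs.
rewrite setIT; apply/seteqP; split=> [y Wy|_ ->//].
apply: c_inj; rewrite ?inE//; apply/eqP.
move: (Wsmall _ _ Wy Wx); rewrite !fgE.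
have -> : ((c y)%:R - (c x)%:R : R) = ((c y)%:Z - (c x)%:Z)%:~R.
  by rewrite intrD intrN.
by rewrite -intr_norm -[X in _ < X -> _]/(1%:~R) ltr_int; lia.
Qed.

(** A sequence [u n] of quasicontinuous functions and increasing finite sets
[s n] are built together, with [u n.+1 = h - u n] on [s n.+1]. Then
[u n.+2 = h - u n.+1 = u n] on [s n.+1], and choosing [s n.+1] large enough
makes [u n.+2] as close to [u n] as desired for the complete metric. So the even
and the odd terms converge separately, and the two limits add up to [h] as soon
as every point of [X] eventually enters [s n]. *)
Lemma sums_of_completely_metrizable (R : realType) (X : topologicalType) :
  hausdorff_space X -> countable [set: X] -> completely_metrizable R (Qp R X) ->
  forall h : X -> R, exists f g : Qp R X, forall x, val f x + val g x = h x.
Proof.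
move=> hX /countable_injP[c c_inj] [M [phi [psi [phiK psiK cphi cpsi Mc]]]] h.
(* The choices made at each step: [I] interpolates, [A] controls the distance
   to the current term, and [E n] collects the point of code [n], if any. *)
have /choice[I IE] (p : seq X * (X -> R)) :=
  quasicontinuous_interpolation p.1 p.2 hX.
have /choice[A AE] (p : nat * Qp R X) : exists s : seq X, forall g : Qp R X,
    (forall x, x \in s -> val g x = val p.2 x) ->
    ball (phi p.2) (2^-1 ^+ p.1.+1) (phi g).
  have e0 : 0 < (2^-1 : R) ^+ p.1.+1 by rewrite exprn_gt0// invr_gt0.
  exact: (nbhs_Qp_agree (cphi _ _ (nbhsx_ballx _ _ e0))).
have /choice[E EE] (n : nat) : exists s : seq X, forall x, c x = n -> x \in s.
  have [[x <-]|nx] := pselect (exists x, c x = n).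
    by exists [:: x] => y /c_inj ->; rewrite ?inE.
  by exists [::] => x xn; case: nx; exists x.
pose fix p n : Qp R X * seq X :=
  if n is m.+1 then
    let s := (p m).2 ++ A (m, (p m).1) ++ E m in
    (I (s, fun x => h x - val (p m).1 x), s)
  else (I ([::], h), [::]).
pose u n := (p n).1; pose s n := (p n).2.
have s_mono m n : (m <= n)%N -> {subset s m <= s n}.
  move=> /subnKC <-; elim: (n - m)%N => [|k IH]; first by rewrite addn0.
  by move=> x /IH xs; rewrite addnS /s /= mem_cat -/(s _) xs.
have uS n x : x \in s n.+1 -> val (u n.+1) x = h x - val (u n) x.
  by move=> xs; rewrite /u /= IE.
have uSS n x : x \in s n.+1 -> val (u n.+2) x = val (u n) x.
  move=> xs; rewrite uS; last exact: (s_mono n.+1).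
  by rewrite uS// opprB addrC subrK.
have u_ball n : ball (phi (u n)) (2^-1 ^+ n.+1) (phi (u n.+2)).
  apply: (AE (n, u n)) => x xA; apply: uSS.
  by rewrite /s /= !mem_cat -/(u n) xA orbT.
have u_sum n x : (c x <= n)%N -> val (u n) x + val (u n.+1) x = h x.
  move=> cxn; rewrite uS; first by rewrite addrC subrK.
  apply: (s_mono (c x).+1) => //.
  by rewrite /s /= !mem_cat (EE (c x)) ?orbT.
(* [b = 0] gives the even terms of [u], [b = 1] the odd ones. *)
have lim_half b : exists f : Qp R X,
    forall x, (fun n => val (u (b + n.*2)%N) x) @ \oo --> val f x.
  have [|l ul] := Mc (fun n => phi (u (b + n.*2)%N)).
    apply: cauchy_geometric => n; rewrite doubleS !addnS.
    apply: le_ball (u_ball _); rewrite ler_wiXn2l ?invr_ge0 ?invf_le1 ?ler1n//.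
    by rewrite ltnS -addnn addnCA leq_addr.
  exists (psi l) => x.
  have -> : (fun n => val (u (b + n.*2)%N) x) =
    (fun n => val (psi (phi (u (b + n.*2)%N))) x).
    by apply/funext => n; rewrite phiK.
  apply: (cvg_comp (fun n => phi (u (b + n.*2)%N))
    (fun m => val (psi m) x) ul).
  exact: (continuous_comp (cpsi l) (@Qp_eval_continuous R X x _)).
have [f uf] := lim_half 0%N; have [g ug] := lim_half 1%N.
exists f, g => x; apply: (cvg_unique (@Rhausdorff R) (cvgD (uf x) (ug x))).
apply: cvg_near_cst; exists (c x) => // n /= cxn.
by rewrite fctE add0n add1n u_sum// (leq_trans cxn)// -addnn leq_addr.
Qed.

Theorem theorem3p6 (R : realType) (X : topologicalType)
    (X_infinite : infinite_set [set: X]) (X_hausdorff : hausdorff_space X)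
    (QX_cm : completely_metrizable R (Qp R X)) :
  countable [set: X] /\ dense (isolated [set: X]).
Proof.
have X_countable : countable [set: X].
  have [M [phi [psi [phiK _ cphi cpsi _]]]] := QX_cm.
  have [f _] := quasicontinuous_interpolation [::] (fun=> 0 : R) X_hausdorff.
  apply: (@countable_of_countable_nbhs_basis _ _ f
    (fun n => phi @^-1` ball (phi f) n.+1%:R^-1)) => // [n|A fA].
    by apply: cphi; apply: nbhsx_ballx; rewrite invr_gt0.
  have : nbhs (phi f) (psi @^-1` A) by apply: cpsi; rewrite phiK.
  move=> /nbhs_ballP[e /= e0 eA].
  have [n _ /(_ n (leqnn n)) ne] := near_infty_natSinv_lt (PosNum e0).
  exists n => g /= fg; rewrite -(phiK g); apply: eA.
  by apply: le_ball fg; exact: ltW.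
split=> //; apply: (@dense_isolated_of_sums R) => //.
exact: sums_of_completely_metrizable.
Qed.
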